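(* Let $\mathbb{X}$ be a finite-dimensional real polyhedral Banach space and let $\mathbb{Y}$ be a proper linear subspace of $\mathbb{X}$ with $\dim \mathbb{Y} > 1$. Then the following statements are equivalent: (i) $\mathbb{Y}$ is a strongly anti-coproximinal subspace of $\mathbb{X}$; (ii) $\mathbb{Y}$ intersects the interior of every facet of $B_{\mathbb{X}}$, i.e. $\mathbb{Y} \cap int(F) \ne \emptyset$ for every facet $F$ of $B_{\mathbb{X}}$; (iii) $\mathcal{J}_{\mathbb{Y}} = Ext(B_{\mathbb{X}^*})$.
   Context: $B_{\mathbb{X}}$, $S_{\mathbb{X}}$ denote the closed unit ball and unit sphere, and $Ext(A)$ the set of extreme points of a convex set $A$. A finite-dimensional Banach space is polyhedral if $Ext(B_{\mathbb{X}})$ is finite. A convex set $F \subset S_{\mathbb{X}}$ is a face of $B_{\mathbb{X}}$ if whenever $x_1, x_2 \in S_{\mathbb{X}}$ and $0 < t < 1$ satisfy $(1-t)x_1 + t x_2 \in F$, one has $x_1, x_2 \in F$. A facet is a maximal face. $int(F)$ is the relative interior of $F$ (the interior of $F$ in its affine hull). For nonzero $x$, $J(x) = \{f \in S_{\mathbb{X}^*} : f(x) = \|x\|\}$; $x$ is smooth if $J(x)$ is a singleton; $Sm(\mathbb{X})$ is the set of smooth points. $\mathcal{J}_{\mathbb{Y}} = \{f \in S_{\mathbb{X}^*} : f(y) = 1 \text{ for some } y \in Sm(\mathbb{X}) \cap S_{\mathbb{Y}}\}$ (empty if $Sm(\mathbb{X}) \cap S_{\mathbb{Y}} = \emptyset$).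 For $\epsilon \in [0,1)$ and $x, y \in \mathbb{X}$, $x \perp_B^{\epsilon} y$ means $\|x + \lambda y\|^2 \ge \|x\|^2 - 2\epsilon \|x\| \|\lambda y\|$ for all $\lambda \in \mathbb{R}$ (it is known that this is equivalent to $\|x+\lambda y\| \ge \|x\| - \epsilon\|\lambda y\|$ for all $\lambda \in \mathbb{R}$). An element $y_0 \in \mathbb{Y}$ is an $\epsilon$-best coapproximation to $x$ out of $\mathbb{Y}$ if $y \perp_B^{\epsilon} (x - y_0)$ for all $y \in \mathbb{Y}$. $\mathbb{Y}$ is a strongly anti-coproximinal subspace of $\mathbb{X}$ if for every $x \in \mathbb{X} \setminus \mathbb{Y}$ and every $\epsilon \in [0,1)$ there does not exist any $\epsilon$-best coapproximation to $x$ out of $\mathbb{Y}$. *)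

(* Defs.v *)
From HB Require Import structures.
From mathcomp Require Import all_boot all_order all_algebra.
From mathcomp Require Import all_classical all_reals all_analysis.

Set Implicit Arguments.
Unset Strict Implicit.
Unset Printing Implicit Defensive.

Import Order.TTheory GRing.Theory Num.Theory.
Import numFieldNormedType.Exports.

Local Open Scope classical_set_scope.
Local Open Scope ring_scope.

(* Over a realType, completeness and the continuity of every linear map are
   automatic in finite dimension, so no completeness axiom is recorded and the
   dual space of X is the whole space of linear forms 'Hom(X, R^o). *)
#[short(type="finNormedModType")]
HB.structure Definition FinNormedModule (R : numFieldType) :=
  {V of NormedModule R V & Vector R V}.

Section convexity.
Context {R : numFieldType} {V : lmodType R}.
Implicit Type A : set V.

Definition extreme_points A : set V :=
  [set x | A x /\ forall y z (t : R), A y -> A z -> 0 < t < 1 ->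
     x = (1 - t) *: y + t *: z -> y = x /\ z = x].

Definition affine_set A : Prop :=
  forall x y (t : R), A x -> A y -> A ((1 - t) *: x + t *: y).

Definition affine_hull A : set V := smallest affine_set A.

End convexity.

Section geometry.
Context {R : realType} {X : finNormedModType R}.
Implicit Types (F : set X) (Y : {vspace X}) (x y : X) (f : 'Hom(X, R^o)).

Definition unit_ball : set X := [set x | `|x| <= 1].

Definition unit_sphere : set X := [set x | `|x| = 1].

(* The set is nonempty and bounded above since dim X is finite, so this [sup]
   is the operator norm. *)
Definition dual_norm f : R := sup [set `|f x| | x in unit_ball].

Definition dual_unit_ball : set 'Hom(X, R^o) := [set f | dual_norm f <= 1].

Definition dual_unit_sphere : set 'Hom(X, R^o) := [set f | dual_norm f = 1].

Definition face F : Prop :=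
  [/\ convex_set F, F `<=` unit_sphere &
      forall x1 x2 (t : R), unit_sphere x1 -> unit_sphere x2 -> 0 < t < 1 ->
        F ((1 - t) *: x1 + t *: x2) -> F x1 /\ F x2].

Definition facet F : Prop :=
  face F /\ forall G : set X, face G -> F `<=` G -> G = F.

(* [subspace A] refines the trace topology only at points outside A; as F is
   included in its affine hull, this is the interior of F in that hull. *)
Definition relative_interior F : set X :=
  @interior (subspace (affine_hull F)) F.

(* J(x), used for x != 0 only *)
Definition support_functionals x : set 'Hom(X, R^o) :=
  [set f | dual_unit_sphere f /\ f x = `|x|].

Definition smooth x : Prop :=
  x != 0 /\ exists f, support_functionals x = [set f].

(* the set written with a calligraphic J indexed by Y *)
Definition smooth_functionals Y : set 'Hom(X, R^o) :=
  [set f | dual_unit_sphere f /\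
     exists y, [/\ smooth y, y \in Y, unit_sphere y & f y = 1]].

Definition approx_BJ_orthogonal (eps : R) x y : Prop :=
  forall lambda : R,
    `|x + lambda *: y| ^+ 2 >=
    `|x| ^+ 2 - 2 * eps * `|x| * `|lambda *: y|.

Definition best_coapproximation (eps : R) Y x y0 : Prop :=
  y0 \in Y /\ forall y, y \in Y -> approx_BJ_orthogonal eps y (x - y0).

Definition strongly_anti_coproximinal Y : Prop :=
  forall x (eps : R), x \notin Y -> 0 <= eps < 1 ->
    ~ exists y0, best_coapproximation eps Y x y0.

End geometry.

Arguments unit_ball {R} X.
Arguments unit_sphere {R} X.
Arguments dual_unit_ball {R} X.
Arguments dual_unit_sphere {R} X.

Definition polyhedral (R : realType) (X : finNormedModType R) : Prop :=
  finite_set (extreme_points (unit_ball X)).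

(* Main.v *)
Require Import Defs.
From HB Require Import structures.
From mathcomp Require Import all_boot all_order all_algebra.
From mathcomp Require Import all_classical all_reals all_analysis.
From mathcomp Require Import ring lra zify.

Set Implicit Arguments.
Unset Strict Implicit.
Unset Printing Implicit Defensive.

Import Order.TTheory GRing.Theory Num.Theory.
Import numFieldNormedType.Exports.

Local Open Scope classical_set_scope.
Local Open Scope ring_scope.

(* Write G for the set of extreme points of the dual ball.  The unit ball has
   finitely many extreme points and every linear form attains its maximum over
   the ball at one of them, so the dual ball is cut out by finitely many linear
   inequalities; hence G is finite and norms X.  The facets of the ball are
   exactly the sets [`|x| = f x = 1] with f in G, and a unit vector lies in the
   relative interior of such a facet if and only if f is its only support
   functional.
   If Y misses the interior of the facet of f, pick z in that interior: every
   y in Y is normed by some g in G with [|g z| <= eps], where eps < 1 is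
   uniform since G is finite, so 0 is an eps-best coapproximation to z.
   Conversely, at a smooth point of Y supported by f, approximate orthogonality
   to x - y0 forces [f (x - y0) <= eps * `|x - y0|]; this cannot hold for all f
   in G since one of them norms x - y0. *)

(** * Compactness of the ball and maximisation of linear forms *)

Section compactness.
Context {R : realType}.
Import VectorInternalTheory.

Lemma rV_linear_continuous n (W : normedModType R)
    (L : {linear 'rV[R]_n -> W}) : continuous L.
Proof.
have -> : (L : 'rV[R]_n -> W) = fun v => \sum_i v ord0 i *: L (delta_mx 0 i).
  apply/funext => v; rewrite {1}(row_sum_delta v) linear_sum.
  by apply: eq_bigr => i _; rewrite linearZ.
move=> v; apply: (@cvg_big _ _ _ _ _ add_continuous _ (nbhs v)) => i _.
by apply: continuousZr_tmp; exact: coord_continuous.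
Qed.

Context {X : finNormedModType R}.

Let ball_coords : set 'rV[R]_(dim X) := [set v | `|r2v v : X| <= 1].

Let norm_r2v_continuous : continuous (fun v : 'rV[R]_(dim X) => `|r2v v : X|).
Proof.
move=> v; apply: (@continuous_comp _ _ _ (@r2v _ X) Num.norm).
  exact: rV_linear_continuous.
exact: norm_continuous.
Qed.

(** The norm of [X] is continuous and positive on the compact sphere of the coordinate norm, so it
    has a positive minimum there; homogeneity does the rest. *)
Let norm_lower_bound :
  exists2 m : R, 0 < m & forall v : 'rV[R]_(dim X), m * `|v| <= `|r2v v : X|.
Proof.
pose S := [set v : 'rV[R]_(dim X) | `|v| = 1].
have nv_unit (v : 'rV[R]_(dim X)) : v != 0 -> S (`|v|^-1 *: v).
  move=> v0; rewrite /S /= normrZ ger0_norm ?invr_ge0 ?normr_ge0// mulVf//.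
  by rewrite normr_eq0.
(* [S] is empty exactly when [X] has dimension 0. *)
have [S0|S0] := pselect (S !=set0); last first.
  exists 1 => // v; have [->|/nv_unit Sv] := eqVneq v 0.
    by rewrite normr0 mulr0.
  by case: S0; exists (`|v|^-1 *: v).
have Scompact : compact S.
  apply: bounded_closed_compact.
    exists 1; split; first exact: num_real.
    by move=> M M1 v /= ->; exact: ltW.
  rewrite (_ : S = Num.norm @^-1` [set 1]); last by apply/seteqP; split.
  apply: (continuous_closedP _).1; first exact: norm_continuous.
  exact: closed_eq.
have [c /set_mem Sc cmin] :=
  EVT_min_rV S0 Scompact (continuous_subspaceT norm_r2v_continuous).
exists `|r2v c : X|.
  rewrite normr_gt0 -(inj_eq (can_inj v2rK)) r2vK linear0.
  by apply/eqP => c0; move: Sc; rewrite /S /= c0 normr0 => /esym/eqP; rewrite oner_eq0.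
move=> v; have [->|v0] := eqVneq v 0; first by rewrite normr0 mulr0.
have /mem_set/cmin := nv_unit _ v0.
rewrite linearZ /= normrZ ger0_norm ?invr_ge0 ?normr_ge0//.
by rewrite mulrC ler_pdivlMr ?normr_gt0// .
Qed.

Let ball_coords_compact : compact ball_coords.
Proof.
have [m m0 mle] := norm_lower_bound.
apply: bounded_closed_compact.
  exists m^-1; split; first exact: num_real.
  move=> M mM v /= v1; apply: le_trans (ltW mM).
  by rewrite -[m^-1]mul1r ler_pdivlMr// mulrC (le_trans (mle v)).
rewrite (_ : ball_coords = (fun v => `|r2v v : X|) @^-1` [set r | r <= 1]) //.
apply: (continuous_closedP _).1; first exact: norm_r2v_continuous.
exact: closed_le.
Qed.

(* Among the maximisers of [f] on the ball, one that maximises the strictly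
   convex sum of squares of the coordinates is an extreme point. *)
Lemma linear_max_extreme_point (f : 'Hom(X, R^o)) :
  exists2 e : X, extreme_points (unit_ball X) e &
    forall x, unit_ball X x -> f x <= f e.
Proof.
have fcont : continuous (fun v : 'rV[R]_(dim X) => f (r2v v)).
  exact: (@rV_linear_continuous _ R^o (f \o r2v)).
have ball0 : ball_coords !=set0.
  by exists 0; rewrite /ball_coords /= linear0 normr0.
have [c /set_mem Bc cmax] :=
  EVT_max_rV ball0 ball_coords_compact (continuous_subspaceT fcont).
pose K := ball_coords `&` [set v | f (r2v v) = f (r2v c)].
have Kcompact : compact K.
  apply: compact_closedI ball_coords_compact _.
  apply: (continuous_closedP _).1 fcont [set f (r2v c)] _.
  exact: closed_eq.
have K0 : K !=set0 by exists c.
pose q (v : 'rV[R]_(dim X)) := \sum_i v ord0 i ^+ 2.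
have qcont : continuous q.
  move=> v; apply: (@cvg_big _ _ _ _ _ add_continuous _ (nbhs v)) => i _.
  apply: (@continuous_comp _ _ _ (fun w : 'rV[R]_(dim X) => w ord0 i)
    (fun r : R => r ^+ 2)); first exact: coord_continuous.
  exact: exprn_continuous.
have [a /set_mem [Ba fa] amax] := EVT_max_rV K0 Kcompact (continuous_subspaceT qcont).
have fmax x : unit_ball X x -> f x <= f (r2v a).
  move=> x1; rewrite fa; rewrite -[x]v2rK; apply: cmax; apply/mem_set.
  by rewrite /ball_coords /= v2rK.
exists (r2v a) => //; split=> // y z t y1 z1 /andP[t0 t1] ayz.
have t1' : 0 < 1 - t by rewrite subr_gt0.
have [fy fz] : f y = f (r2v a) /\ f z = f (r2v a).
  have := fmax _ y1; have := fmax _ z1.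
  move: ayz => /(congr1 f); rewrite linearD !linearZ /= => ayz.
  rewrite /GRing.scale /= in ayz.
  move=> z_le y_le.
  by split; nra.
have qy : q (v2r y) <= q a.
  by apply/amax/mem_set; split; rewrite /ball_coords /= v2rK// fy fa.
have qz : q (v2r z) <= q a.
  by apply/amax/mem_set; split; rewrite /ball_coords /= v2rK// fz fa.
have aE : a = (1 - t) *: v2r y + t *: v2r z.
  by rewrite -[LHS]r2vK ayz linearD !linearZ.
(* If the squared distance [D] were positive, strict convexity would put [q a] strictly below a
   convex combination of values that are at most [q a]. *)
pose D := \sum_i (v2r y ord0 i - v2r z ord0 i) ^+ 2.
have qE : q a = (1 - t) * q (v2r y) + t * q (v2r z) - t * (1 - t) * D.
  rewrite /q /D !mulr_sumr -big_split -sumrB /=; apply: eq_bigr => i _.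
  rewrite {1}aE !mxE; ring.
have D0 : D = 0.
  have: 0 <= D by apply: sumr_ge0 => i _; exact: sqr_ge0.
  rewrite le_eqVlt => /predU1P[//|D_gt0].
  have := mulr_gt0 (mulr_gt0 t0 t1') D_gt0.
  have := ler_wpM2l (ltW t1') qy; have := ler_wpM2l (ltW t0) qz.
  by lra.
have yz : y = z.
  apply: (can_inj (@v2rK _ X)); apply/rowP => i; apply/eqP.
  rewrite -subr_eq0 -sqrf_eq0; apply/eqP; move: i isT.
  by apply/psumr_eq0P => [i _|//]; exact: sqr_ge0.
by rewrite ayz -yz -scalerDl subrK scale1r.
Qed.

End compactness.

(** * Support functionals and Hahn-Banach extension *)

Section duality.
Context {R : realType} {X : finNormedModType R}.
Implicit Types (f g : 'Hom(X, R^o)) (x y v : X) (U : {vspace X}).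

Lemma le_extreme_points_norm f (M : R) :
  (forall e, extreme_points (unit_ball X) e -> f e <= M) ->
  forall x, f x <= M * `|x|.
Proof.
move=> fM x; have [e eext emax] := linear_max_extreme_point f.
have [->|x0] := eqVneq x 0; first by rewrite linear0 normr0 mulr0.
have x0' : 0 < `|x| by rewrite normr_gt0.
rewrite -ler_pdivrMr// (le_trans _ (fM _ eext))//.
have := emax (`|x|^-1 *: x); rewrite linearZ /= /GRing.scale /= mulrC; apply.
by rewrite /unit_ball /= normrZ ger0_norm ?invr_ge0 ?normr_ge0// mulVf ?gt_eqF.
Qed.

(** Bounds the set whose supremum is [dual_norm], so that [sup] is a genuine supremum. *)
Lemma linear_form_bounded f : exists2 M : R, 0 <= M & forall x, `|f x| <= M * `|x|.
Proof.
have [e _ emax] := linear_max_extreme_point f.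
have fe x : f x <= f e * `|x|.
  by apply: le_extreme_points_norm => y [y1 _]; exact: emax.
exists (f e) => [|x].
  by have := emax 0; rewrite /unit_ball /= normr0 linear0; apply.
by rewrite ler_norml fe andbT lerNl -linearN -normrN fe.
Qed.

(** A one-sided bound is enough because [x] can be replaced by [- x]. *)
Lemma dual_unit_ballP f : dual_unit_ball X f <-> forall x, f x <= `|x|.
Proof.
have [M M0 fM] := linear_form_bounded f.
rewrite /dual_unit_ball /dual_norm /=; split=> [f1 x|f1].
  rewrite -[leRHS]mul1r; apply: le_extreme_points_norm => e [e1 _].
  apply: le_trans f1; apply: le_trans (ler_norm _) _.
  apply: ub_le_sup; last by exists e.
  exists M => _ [y /= y1 <-]; apply: le_trans (fM y) _.
  by rewrite ler_piMr.
apply: ge_sup; first by exists `|f 0|, 0 => //; rewrite /unit_ball /= normr0.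
move=> _ [y y1 <-]; apply: le_trans y1.
by rewrite ler_norml f1 andbT lerNl -linearN -normrN f1.
Qed.

Lemma dual_unit_ball_le f x : dual_unit_ball X f -> f x <= `|x|.
Proof. by move/dual_unit_ballP; apply. Qed.

Lemma dual_unit_ballN f : dual_unit_ball X f -> dual_unit_ball X (- f).
Proof.
move=> /dual_unit_ballP f1; apply/dual_unit_ballP => x.
by rewrite opp_lfunE -linearN -[leRHS]normrN f1.
Qed.

Lemma dual_unit_sphere_ball f : dual_unit_sphere X f -> dual_unit_ball X f.
Proof. by rewrite /dual_unit_sphere /dual_unit_ball /= => ->. Qed.

(** A form of the dual ball norming a nonzero [x] has norm exactly 1, attained at the normalised
    [x]. *)
Lemma support_functionalsP f x : x != 0 ->
  support_functionals x f <-> dual_unit_ball X f /\ f x = `|x|.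
Proof.
move=> x0; split=> -[f1 fx]; first by split => //; exact: dual_unit_sphere_ball.
split=> //; apply/eqP; rewrite eq_le f1 /=.
have x0' : `|x| != 0 by rewrite normr_eq0.
have [M M0 fM] := linear_form_bounded f.
apply: ub_le_sup.
  exists M => _ [y /= y1 <-]; apply: le_trans (fM y) _.
  by rewrite ler_piMr.
exists (`|x|^-1 *: x).
  by rewrite /unit_ball /= normrZ ger0_norm ?invr_ge0 ?normr_ge0// mulVf.
by rewrite linearZ /= fx /GRing.scale /= mulVf// normr1.
Qed.

(** A basis of [U] together with [v] is free; the form is the coordinate along [v]. *)
Lemma linear_form_vanishing U v : v \notin U ->
  exists2 g : 'Hom(X, R^o), (forall u, u \in U -> g u = 0) & g v = 1.
Proof.
move=> vU; pose b := [tuple of v :: vbasis U].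
have bfree : free b.
  by rewrite free_cons (span_basis (vbasisP U)) vU (basis_free (vbasisP U)).
exists (linfun (coord b ord0 : {linear X -> R^o})) => [u uU|]; rewrite lfunE /=.
  rewrite (coord_vbasis uU) linear_sum big1// => i _; rewrite linearZ /=.
  by rewrite (coord_free (lift ord0 i) ord0 bfree) /GRing.scale /= mulr0.
by rewrite (coord_free ord0 ord0 bfree).
Qed.

(** The value [c] given to [v] must satisfy [f u - |u - v| <= c <= |w + v| - f w] for all [u] and
    [w] in [U]. The triangle inequality puts every left side below every right side, and [c] is the
    supremum of the left sides. *)
Let hahn_banach_step U v f : v \notin U -> (forall u, u \in U -> f u <= `|u|) ->
  exists f' : 'Hom(X, R^o), (forall u, u \in U -> f' u = f u) /\
    forall u, u \in (U + <[v]>)%VS -> f' u <= `|u|.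
Proof.
move=> vU fU; have [g gU gv] := linear_form_vanishing vU.
pose S := [set f u - `|u - v| | u in [set` U]].
have Sub w : w \in U -> ubound S (`|w + v| - f w).
  move=> wU _ [u /= uU <-]; rewrite lerBlDr addrAC lerBrDr -linearD.
  apply: le_trans (fU _ (rpredD uU wU)) _.
  rewrite (_ : u + w = (w + v) + (u - v)) ?ler_normD//.
  by rewrite [RHS]addrACA subrr addr0 addrC.
have S0 : S !=set0 by exists (f 0 - `|0 - v|), 0 => //=; exact: mem0v.
pose c := sup S.
have c_le w : w \in U -> f w + c <= `|w + v|.
  by move=> wU; rewrite addrC -lerBrDr; apply: ge_sup => //; exact: Sub.
have c_ge u : u \in U -> f u - c <= `|u - v|.
  move=> uU; rewrite lerBlDl -lerBlDr; apply: ub_le_sup; last by exists u.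
  by exists (`|0 + v| - f 0); apply: Sub; exact: mem0v.
exists (f + (c - f v) *: g); split=> [u uU|_ /memv_addP[u uU [_ /vlineP[t ->] ->]]].
  by rewrite add_lfunE scale_lfunE gU// scaler0 addr0.
have -> : (f + (c - f v) *: g) (u + t *: v) = f u + t * c.
  rewrite add_lfunE scale_lfunE !linearD !linearZ /= gU// gv /GRing.scale /=; ring.
(* For nonzero [t], dividing by its absolute value reduces to [c_ge] or [c_le]. *)
have [t0|t0|->] := ltgtP t 0.
- have := c_ge _ (memvZ (- t)^-1 uU); rewrite linearZ /= /GRing.scale /=.
  have t0' : 0 < - t by rewrite oppr_gt0.
  rewrite -(ler_pM2l t0') mulrBr mulrA divff ?gt_eqF// mul1r mulNr opprK.
  move/le_trans; apply; rewrite -{1}(ger0_norm (ltW t0')) -normrZ scalerBr scalerA.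
  by rewrite divff ?gt_eqF// scale1r scaleNr opprK.
- have := c_le _ (memvZ t^-1 uU); rewrite linearZ /= /GRing.scale /=.
  rewrite -(ler_pM2l t0) mulrDr mulrA divff ?gt_eqF// mul1r.
  move/le_trans; apply; rewrite -{1}(ger0_norm (ltW t0)) -normrZ scalerDr scalerA.
  by rewrite divff ?gt_eqF// scale1r.
- by rewrite mul0r addr0 scale0r addr0 fU.
Qed.

Lemma hahn_banach U f : (forall u, u \in U -> f u <= `|u|) ->
  exists2 f' : 'Hom(X, R^o), (forall u, u \in U -> f' u = f u) & dual_unit_ball X f'.
Proof.
have [n] := ubnP (\dim {:X} - \dim U); elim: n U f => // n IHn U f Un fU.
have [UX|] := eqVneq U fullv.
  by exists f => //; apply/dual_unit_ballP => x; apply: fU; rewrite UX memvf.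
move=> UX; have /subvPn[v _ vU] : ~~ (fullv <= U)%VS.
  by apply: contra UX => XU; apply/eqP/subv_anti; rewrite subvf.
have [f' [f'f f'U]] := hahn_banach_step vU fU.
have [|f'' f''f' f''1] := IHn (U + <[v]>)%VS f' _ f'U.
  have lt1 : (\dim U < \dim (U + <[v]>))%N.
    rewrite (ltn_leqif (dimv_leqif_sup (addvSl _ _))).
    by apply: contra vU => /subvP; apply; rewrite (subvP (addvSr _ _))// memv_line.
  by move: (dimvS (subvf (U + <[v]>)%VS)) Un; lia.
by exists f'' => // u uU; rewrite f''f' ?f'f// (subvP (addvSl _ _)).
Qed.

Lemma norming_functional x :
  exists2 f : 'Hom(X, R^o), dual_unit_ball X f & f x = `|x|.
Proof.
have [->|x0] := eqVneq x 0.
  exists 0; last by rewrite linear0 normr0.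
  by apply/dual_unit_ballP => y; rewrite zero_lfunE.
have [g _ gx] : exists2 g : 'Hom(X, R^o), (forall u, u \in 0%VS -> g u = 0) & g x = 1.
  by apply: linear_form_vanishing; rewrite memv0.
have [u /vlineP[t ->]|f fx f1] := @hahn_banach <[x]> (`|x| *: g).
  rewrite scale_lfunE linearZ /= gx /GRing.scale /= normrZ mulr1 mulrC.
  by rewrite ler_wpM2r// ler_norm.
by exists f => //; rewrite fx ?memv_line// scale_lfunE gx /GRing.scale /= mulr1.
Qed.

End duality.

(** Turns finitely many strict inequalities into one uniform gap. *)
Lemma seq_strict_bound {R : realDomainType} {T : eqType} (s : seq T)
    (F : T -> R) (c : R) : (forall x, x \in s -> F x < c) ->
  exists2 c', c' < c & forall x, x \in s -> F x <= c'.
Proof.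
elim: s => [_|x s IHs Fc]; first by exists (c - 1) => //; rewrite ltrBlDr ltrDl.
have [y ys|c' c'c Fc'] := IHs; first by apply: Fc; rewrite inE ys orbT.
exists (Num.max (F x) c'); first by rewrite gt_max Fc ?mem_head.
by move=> y; rewrite inE le_max => /predU1P[->|/Fc' ->]; rewrite ?lexx ?orbT.
Qed.

Lemma conv_eq_max {R : realDomainType} (a b m t : R) : a <= m -> b <= m ->
  0 < t < 1 -> (1 - t) * a + t * b = m -> a = m /\ b = m.
Proof. by move=> am bm /andP[t0 t1] abm; split; nra. Qed.

(** * The dual ball of a polyhedral space and its extreme points *)

Section polyhedral_dual.
Context {R : realType} {X : finNormedModType R} (Xpoly : polyhedral X).
Implicit Types (f g h d : 'Hom(X, R^o)) (x y z v e : X).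

Lemma extreme_seq :
  exists s : seq X, forall e, extreme_points (unit_ball X) e <-> e \in s.
Proof. by have /finite_seqP[s sE] := Xpoly; exists s => e; rewrite sE. Qed.

Lemma dual_ball_extremeP f : dual_unit_ball X f <->
  forall e, extreme_points (unit_ball X) e -> f e <= 1.
Proof.
split=> [/dual_unit_ballP f1 e [e1 _]|f1]; first exact: le_trans (f1 e) e1.
by apply/dual_unit_ballP => x; rewrite -[leRHS]mul1r; exact: le_extreme_points_norm.
Qed.

(** The constraints not tight at [f] have a common slack [1 - c] and [d] is bounded on the ball, so
    a small step along [d] in either direction violates none of them; the tight ones do not move. *)
Lemma dual_ball_perturb f d : dual_unit_ball X f ->
    (forall e, extreme_points (unit_ball X) e -> f e = 1 -> d e = 0) ->
  exists2 delta : R, 0 < delta &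
    dual_unit_ball X (f + delta *: d) /\ dual_unit_ball X (f - delta *: d).
Proof.
move=> /dual_ball_extremeP f1 dtight; have [s sE] := extreme_seq.
have [e|c c1 fc] := @seq_strict_bound _ _ [seq e <- s | f e != 1] f 1.
  by rewrite mem_filter => /andP[fe1 /sE es]; rewrite lt_neqAle fe1 f1.
have [D D0 dD] := linear_form_bounded d.
have D1 : 0 < D + 1 by rewrite ltr_wpDl.
pose delta := (1 - c) / (D + 1).
have delta0 : 0 < delta by rewrite divr_gt0// subr_gt0.
have key e : extreme_points (unit_ball X) e -> f e + delta * `|d e| <= 1.
  move=> eext; have [fe1|fe1] := eqVneq (f e) 1.
    by rewrite fe1 dtight// normr0 mulr0 addr0.
  have fec : f e <= c by apply: fc; rewrite mem_filter fe1; apply/sE.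
  have de : `|d e| <= D + 1.
    by rewrite ler_wpDr// (le_trans (dD e))// ler_piMr//; case: eext.
  have := ler_wpM2l (ltW delta0) de.
  rewrite /delta divfK ?gt_eqF//; lra.
exists delta => //; split; apply/dual_ball_extremeP => e eext;
  apply: le_trans (key e eext).
  by rewrite add_lfunE scale_lfunE lerD2l ler_wpM2l ?(ltW delta0)// ler_norm.
rewrite add_lfunE opp_lfunE scale_lfunE lerD2l -mulrN ler_wpM2l ?(ltW delta0)//.
by rewrite -normrN ler_norm.
Qed.

(* For small delta, both [f + delta (g - f)] and [f - delta (g - f)] stay in the
   dual ball. *)
Lemma dual_extreme_determined f g : extreme_points (dual_unit_ball X) f ->
  (forall e, extreme_points (unit_ball X) e -> f e = 1 -> g e = 1) -> g = f.
Proof.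
move=> [f1 fext] tight.
have [e eext fe1|delta delta0 [fp fm]] := @dual_ball_perturb f (g - f) f1.
  by rewrite add_lfunE opp_lfunE tight// fe1 subrr.
have half01 : 0 < (2^-1 : R) < 1 by rewrite invr_gt0 ltr0n invf_lt1 ?ltr1n.
have [|_ fE] := fext _ _ _ fm fp half01.
  rewrite (_ : 1 - 2^-1 = 2^-1 :> R); last by field.
  rewrite -scalerDr addrACA addNr addr0 -mulr2n -[f *+ 2]scaler_nat scalerA.
  by rewrite mulVf ?scale1r// pnatr_eq0.
move/eqP: fE; rewrite -subr_eq0 addrAC subrr add0r scaler_eq0 gt_eqF//=.
by rewrite subr_eq0 => /eqP.
Qed.

(** An extreme functional is determined by the extreme points of the ball where it is tight, a
    subset of a finite list. *)
Lemma finite_dual_extreme_points :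
  finite_set (extreme_points (dual_unit_ball X)).
Proof.
have [s sE] := extreme_seq.
pose tight f := [set i : 'I_(size s) | f s`_i == 1]%SET.
suff tight_inj : {in extreme_points (dual_unit_ball X) &, injective tight}.
  by rewrite -(eq_finite_set (inj_card_eq tight_inj)); exact: finite_finset.
move=> f g /set_mem fext _ fg; apply/esym/(dual_extreme_determined fext).
move=> e /sE es fe1; have ei : (index e s < size s)%N by rewrite index_mem.
have : Ordinal ei \in tight f by rewrite inE /= nth_index// fe1.
by rewrite fg inE /= nth_index// => /eqP.
Qed.

(* A norming functional at [x] that is tight at as many extreme points of the
   ball as possible is extreme: otherwise it can be moved along a segment of
   norming functionals until one more extreme point becomes tight. *)
Lemma dual_extreme_norming x :
  exists2 f, extreme_points (dual_unit_ball X) f & f x = `|x|.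
Proof.
have [s sE] := extreme_seq.
have s_ext (i : 'I_(size s)) : extreme_points (unit_ball X) s`_i.
  by apply/sE; rewrite mem_nth.
pose tight f := [set i : 'I_(size s) | f s`_i == 1]%SET.
pose P k := `[< exists f, [/\ dual_unit_ball X f, f x = `|x| & #|tight f| = k] >].
have exP : exists k, P k.
  have [f f1 fx] := norming_functional x.
  by exists #|tight f|; apply/asboolP; exists f.
have ubP k : P k -> (k <= size s)%N.
  by move=> /asboolP[f [_ _ <-]]; rewrite -[leqRHS]card_ord max_card.
have [k /asboolP[f [f1 fx fk]] kmax] := ex_maxnP exP ubP.
have {}kmax f' : dual_unit_ball X f' -> f' x = `|x| -> ~ tight f \proper tight f'.
  move=> f'1 f'x /proper_card; rewrite fk ltnNge => /negP; apply.
  by apply: kmax; apply/asboolP; exists f'.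
exists f => //; split=> // g h t g1 h1 t01 fE.
suff gh : g = h by rewrite fE gh -scalerDl subrK scale1r.
have fE' y : f y = (1 - t) * g y + t * h y.
  by rewrite fE add_lfunE !scale_lfunE.
have [gx hx] : g x = `|x| /\ h x = `|x|.
  apply: conv_eq_max t01 _; rewrite -?fE'//; exact: dual_unit_ball_le.
have g1e := (dual_ball_extremeP g).1 g1; have h1e := (dual_ball_extremeP h).1 h1.
have f1e := (dual_ball_extremeP f).1 f1.
have d_tight e : extreme_points (unit_ball X) e -> f e = 1 -> (g - h) e = 0.
  move=> eext fe1; have [ge he] : g e = 1 /\ h e = 1.
    by apply: conv_eq_max t01 _; rewrite ?g1e ?h1e// -fE'.
  by rewrite add_lfunE opp_lfunE ge he subrr.
have [[i0 di0]|d_le0] := pselect (exists i : 'I_(size s), 0 < (g - h) s`_i).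
  (* Ratio test: moving along [g - h], constraint [i] becomes tight at step [r i]. The smallest such
     step stays in the dual ball, keeps the value at [x] and all tight indices, and adds a new
     one. *)
  pose r (i : 'I_(size s)) := (1 - f s`_i) / (g - h) s`_i.
  have [i /= di rmin] := arg_minP (P := fun i : 'I_(size s) => 0 < (g - h) s`_i) r di0.
  have r0 : 0 <= r i by rewrite divr_ge0 ?subr_ge0 ?f1e// ltW.
  have f'E y : (f + r i *: (g - h)) y = f y + r i * (g - h) y.
    by rewrite add_lfunE scale_lfunE.
  case: (@kmax (f + r i *: (g - h))).
  - apply/dual_ball_extremeP => _ /sE /(nthP 0)[j js <-]; rewrite f'E.
    have [dj|dj] := ltP 0 ((g - h) s`_j).
      by rewrite -lerBrDl -ler_pdivlMr//; exact: (rmin (Ordinal js)).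
    rewrite (le_trans _ (f1e _ (s_ext (Ordinal js))))// gerDl.
    by rewrite mulr_ge0_le0.
  - by rewrite f'E fx add_lfunE opp_lfunE gx hx subrr mulr0 addr0.
  - apply/properP; split.
      apply/fintype.subsetP => j; rewrite !inE f'E => /eqP fj.
      by rewrite fj d_tight// mulr0 addr0.
    exists i; rewrite !inE.
      by rewrite f'E /r divfK ?(gt_eqF di)// addrC subrK.
    apply/eqP => fi; move: di; rewrite d_tight ?ltxx//.
(* Otherwise [g - h] is nonpositive at all extreme points of the ball, hence on [X], and applying
   this to [- y] makes it vanish. *)
apply/eqP; rewrite -subr_eq0; apply/eqP/lfunP => y.
have dle0 z : (g - h) z <= 0.
  rewrite -(mul0r `|z|); apply: le_extreme_points_norm => _ /sE /(nthP 0)[j js <-].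
  by rewrite leNgt; apply/negP => dj; apply: d_le0; exists (Ordinal js).
rewrite zero_lfunE; apply: le_anti; rewrite dle0 /=.
by have := dle0 (- y); rewrite linearN oppr_le0.
Qed.

(* [z] is the barycentre of the extreme points of the ball where [f] equals 1. *)
Lemma dual_exposing_point f : extreme_points (dual_unit_ball X) f ->
    (exists v : X, v != 0) ->
  exists z, [/\ `|z| = 1, f z = 1 &
    forall g, dual_unit_ball X g -> g z = 1 -> g = f].
Proof.
move=> fext [v v0]; have [s sE] := extreme_seq.
have f1 := (dual_unit_ballP f).1 fext.1.
pose t := [seq e <- s | f e == 1]; pose n : R := (size t)%:R.
have tP e : e \in t <-> extreme_points (unit_ball X) e /\ f e = 1.
  rewrite mem_filter; split=> [/andP[/eqP fe /sE]//|[/sE -> ->]].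
  by rewrite eqxx.
(* If [f] were tight nowhere, every functional would equal [f] by a vacuous criterion; all would be
   0, and none would norm [v]. *)
have n0 : 0 < n.
  rewrite ltr0n lt0n size_eq0; apply/eqP => t0.
  have f_all g : g = f.
    apply: dual_extreme_determined => // e eext fe.
    by have := (tP e).2 (conj eext fe); rewrite t0.
  have [g _ gv] := norming_functional v.
  by move: v0; rewrite -normr_eq0 -gv (f_all g) -(f_all 0) zero_lfunE eqxx.
have sum1 : \sum_(e <- t) (1 : R) = n by rewrite big_const_seq count_predT iter_addr_0.
pose z := n^-1 *: \sum_(e <- t) e.
have gz g : g z = n^-1 * \sum_(e <- t) g e by rewrite /z linearZ linear_sum.
have fz : f z = 1.
  rewrite gz (_ : \sum_(e <- t) f e = n) ?mulVf ?gt_eqF//.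
  by rewrite -sum1; apply: eq_big_seq => e /tP[].
exists z; split=> //.
  apply: le_anti; rewrite -[X in _ && (X <= _)]fz f1 andbT.
  rewrite /z normrZ ger0_norm ?invr_ge0 ?(ltW n0)// mulrC ler_pdivrMr// mul1r.
  apply: le_trans (ler_norm_sum _ _ _) _; rewrite -sum1.
  by rewrite big_seq [leRHS]big_seq; apply: ler_sum => e /tP[[]].
move=> g /dual_unit_ballP g1 gz1; apply: dual_extreme_determined => // e eext fe.
(* The values [g e] over [t] have mean 1 and none exceeds 1, so each is 1. *)
have : \sum_(e <- t) (1 - g e) = 0.
  rewrite sumrB sum1; apply/eqP; rewrite subr_eq0 eq_sym; apply/eqP.
  by apply: (mulfI (_ : n^-1 != 0)); rewrite ?invr_eq0 ?gt_eqF// -gz gz1 mulVf ?gt_eqF.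
rewrite big_seq => /eqP; rewrite psumr_eq0 => [/allP/(_ e)|e' /tP[[e'1 _] _]]; last first.
  by rewrite subr_ge0 (le_trans (g1 e')).
have et : e \in t by apply/tP.
by rewrite et /= subr_eq0 => /(_ isT)/eqP.
Qed.

End polyhedral_dual.

(** * Facets as exposed faces, their interiors, and smooth points *)

Section facets.
Context {R : realType} {X : finNormedModType R}.
Implicit Types (f g h : 'Hom(X, R^o)) (x y z w e : X) (F : set X).

Definition exposed_face f : set X := unit_sphere X `&` [set x | f x = 1].

Lemma convex_setP (V : lmodType R) (A : set V) : convex_set A <->
  forall (x y : V) t, A x -> A y -> 0 <= t <= 1 -> A ((1 - t) *: x + t *: y).
Proof.
split=> [cA x y t Ax Ay /andP[t0 t1]|cA x y t /set_mem Ax /set_mem Ay].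
  have := cA y x (Itv01 t0 t1) (mem_set Ay) (mem_set Ax).
  by move/set_mem; rewrite /conv /= addrC.
apply/mem_set; rewrite /conv /= addrC; apply: cA => //.
by apply/andP; split.
Qed.

Lemma exposed_faceP f x : dual_unit_ball X f ->
  exposed_face f x <-> `|x| <= 1 /\ f x = 1.
Proof.
move=> f1; split=> -[x1 fx]; split=> //; first by rewrite x1.
by apply: le_anti; rewrite x1 -fx dual_unit_ball_le.
Qed.

Lemma exposed_face_face f : dual_unit_ball X f -> face (exposed_face f).
Proof.
move=> f1; split=> [|x []//|x y t x1 y1 t01 [_ /=]].
  apply/convex_setP => x y t [x1 fx] [y1 fy] /andP[t0 t1].
  rewrite /unit_sphere /= in x1 y1 fx fy.
  have fxy : f ((1 - t) *: x + t *: y) = 1.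
    by rewrite linearD !linearZ /= fx fy /GRing.scale /= !mulr1 subrK.
  apply/(exposed_faceP _ f1); split=> //.
  rewrite (le_trans (ler_normD _ _))// !normrZ x1 y1 !ger0_norm ?subr_ge0//.
  by rewrite !mulr1 subrK.
rewrite linearD !linearZ /= => fxy.
rewrite /unit_sphere /= in x1 y1.
have [||fx fy] := conv_eq_max _ _ t01 fxy.
- by rewrite -x1 dual_unit_ball_le.
- by rewrite -y1 dual_unit_ball_le.
by split.
Qed.

Lemma relative_interiorP F y : relative_interior F y <->
  F y /\ exists2 r : R, 0 < r &
    forall w, affine_hull F w -> `|y - w| < r -> F w.
Proof.
have Fhull : F `<=` affine_hull F by exact: sub_smallest.
rewrite /relative_interior; split=> [yF|[Fy [r r0 Fr]]].
  have Fy : F y by exact: (@interior_subset (subspace (affine_hull F)) F).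
  split=> //; have : @nbhs_subspace _ (affine_hull F) y F by exact: yF.
  rewrite -(nbhs_subspace_in (Fhull _ Fy)) => /nbhs_ballP[r /= r0 rF].
  exists r => // w wF ywr; apply: rF => //.
  by rewrite -ball_normE.
change (@nbhs_subspace _ (affine_hull F) y F).
rewrite -(nbhs_subspace_in (Fhull _ Fy)); apply/nbhs_ballP; exists r => //= w.
rewrite -ball_normE /= => ywr wF.
exact: Fr.
Qed.

Context (Xpoly : polyhedral X).

Lemma dual_extreme_gap f y : `|y| = 1 ->
    (forall g, extreme_points (dual_unit_ball X) g -> g y = 1 -> g = f) ->
  exists2 c, c < 1 &
    forall g, extreme_points (dual_unit_ball X) g -> g != f -> g y <= c.
Proof.
move=> y1 yf; have /finite_seqP[G GE] := finite_dual_extreme_points Xpoly.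
have [g|c c1 yc] := @seq_strict_bound _ _ [seq g <- G | g != f] (fun g => g y) 1.
  rewrite mem_filter => /andP[gf gG].
  have gext : extreme_points (dual_unit_ball X) g by rewrite GE.
  rewrite lt_neqAle -[X in _ && (_ <= X)]y1 dual_unit_ball_le ?andbT; last by case: gext.
  by apply: contra_neq gf; exact: yf.
exists c => // g gext gf; apply: yc; rewrite mem_filter gf.
by move: gext; rewrite GE.
Qed.

(** For [w] in the hull within [1 - c] of [y], [f w = 1] and every other extreme functional is at
    most [c + (1 - c) = 1] at [w]. Extreme functionals norm [X], so [w] stays in the ball. *)
Lemma relative_interior_exposed_face f y : `|y| = 1 -> f y = 1 ->
    dual_unit_ball X f ->
    (forall g, extreme_points (dual_unit_ball X) g -> g y = 1 -> g = f) ->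
  relative_interior (exposed_face f) y.
Proof.
move=> y1 fy f1 yf; have [c c1 yc] := dual_extreme_gap y1 yf.
apply/relative_interiorP; split; first by split.
exists (1 - c) => [|w wF ywc]; first by rewrite subr_gt0.
have fw : f w = 1.
  apply: (wF [set x | f x = 1]); split=> [|x []//] u v t /= fu fv.
  by rewrite linearD !linearZ /= fu fv /GRing.scale /= !mulr1 subrK.
apply/(exposed_faceP _ f1); split=> //.
have [g gext gw] := dual_extreme_norming Xpoly w.
have [gf|gf] := eqVneq g f; first by rewrite -gw gf fw.
rewrite -gw -[w](subrK y) linearD; have := yc _ gext gf.
have := dual_unit_ball_le (w - y) gext.1; rewrite distrC; lra.
Qed.

(** [g] is at most 1 on the face and reaches 1 at an interior point, so it is 1 at every extreme
    point of the ball in the face; tightness identifies it with [f]. *)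
Lemma relative_interior_exposed_face_unique f y :
    extreme_points (dual_unit_ball X) f ->
    relative_interior (exposed_face f) y ->
  forall g, dual_unit_ball X g -> g y = 1 -> g = f.
Proof.
move=> fext /relative_interiorP[[y1 fy] [r r0 Fr]] g g1 gy.
apply: (dual_extreme_determined Xpoly fext) => e [e1 _] fe.
have Fe : exposed_face f e by apply/(exposed_faceP _ fext.1).
have d0 : 0 < `|y - e| + 1 by rewrite ltr_wpDl.
(* A small step from [y] away from [e] stays in the face, where [g <= 1]. *)
have [t t0 tr] : exists2 t, 0 < t & t * `|y - e| < r.
  exists (r / (`|y - e| + 1)); first by rewrite divr_gt0.
  by rewrite mulrAC ltr_pdivrMr// ltr_pM2l// ltrDl.
have [] := Fr ((1 - - t) *: y + - t *: e).
- by move=> A [Aaff FA]; apply: Aaff; apply: FA => //; split.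
- rewrite opprK scalerDl scale1r scaleNr -addrA opprD addNKr -scalerBr.
  by rewrite normrN normrZ gtr0_norm.
move=> w1 _; have := dual_unit_ball_le ((1 - - t) *: y + - t *: e) g1.
rewrite w1 linearD !linearZ /= gy /GRing.scale /= => ge.
apply: le_anti; apply/andP; split.
  by apply: le_trans e1; exact: dual_unit_ball_le.
by rewrite -(ler_pM2l t0); lra.
Qed.

Context (X_neq0 : exists v : X, v != 0).

(** Let [z] be normed by [f] alone. A larger face containing [x] contains the midpoint of [x] and
    [z]; a functional norming it norms both ends, so it is [f], and [f x = 1]. *)
Lemma exposed_face_facet f : extreme_points (dual_unit_ball X) f ->
  facet (exposed_face f).
Proof.
move=> fext; split; first by apply: exposed_face_face; case: fext.
move=> G [Gconv Gsph _] fG; apply/seteqP; split=> // x Gx.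
have [z [z1 fz zf]] := dual_exposing_point Xpoly fext X_neq0.
have Gz : G z by apply: fG; split.
have half01 : 0 <= (2^-1 : R) <= 1 by rewrite invr_ge0 ler0n invf_le1 ?ler1n.
have := Gsph _ ((convex_setP G).1 Gconv _ _ _ Gx Gz half01).
have x1 := Gsph _ Gx.
rewrite /unit_sphere /= in x1 * => xz1.
have [g g1] := norming_functional ((1 - 2^-1) *: x + 2^-1 *: z).
rewrite xz1 linearD !linearZ /= /GRing.scale /= => gxz.
have gx : g x <= 1 by rewrite -x1 dual_unit_ball_le.
have gz : g z <= 1 by rewrite -z1 dual_unit_ball_le.
have [{}gx {}gz] : g x = 1 /\ g z = 1 by split; lra.
by split=> //=; rewrite -(zf g).
Qed.

(** If each extreme functional were below 1 somewhere on [F], successive midpoints of such points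
    would give a point of [F] where all are below 1, although one of them norms it. *)
Lemma facet_exposed_face F : facet F ->
  exists2 f, extreme_points (dual_unit_ball X) f & F = exposed_face f.
Proof.
move=> [[Fconv Fsph _] Fmax].
(* The empty set satisfies [face]; maximality excludes it because nonempty faces exist. *)
have F0 : F !=set0.
  have [v _] := X_neq0; have [f fext _] := dual_extreme_norming Xpoly v.
  have [fface _] := exposed_face_facet fext.
  have [z [z1 fz _]] := dual_exposing_point Xpoly fext X_neq0.
  apply: contrapT => /nonemptyPn F0; have := Fmax _ fface.
  by rewrite F0 => /(_ (@sub0set _ _)) /seteqP[/(_ z) + _]; apply; split.
suff [f fext Ff] : exists2 f, extreme_points (dual_unit_ball X) f &
    forall x, F x -> f x = 1.
  exists f => //; apply/esym/Fmax; first by apply: exposed_face_face; case: fext.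
  by move=> x Fx; split; [exact: Fsph|exact: Ff].
apply: contrapT => noF.
have /finite_seqP[G GE] := finite_dual_extreme_points Xpoly.
suff [x Fx xG] : exists2 x, F x & forall g, g \in G -> g x < 1.
  have [g gext gx] := dual_extreme_norming Xpoly x.
  have := xG g; rewrite gx (Fsph _ Fx : `|x| = 1) ltxx.
  by move: gext; rewrite GE /= => gG /(_ gG).
have : forall g, g \in G -> extreme_points (dual_unit_ball X) g.
  by move=> g gG; rewrite GE.
elim: G {GE} => [_|g G IHG Gext]; first by have [x Fx] := F0; exists x.
have [h hG|x Fx xG] := IHG; first by apply: Gext; rewrite inE hG orbT.
have gext : extreme_points (dual_unit_ball X) g by apply: Gext; rewrite mem_head.
have leF h u : extreme_points (dual_unit_ball X) h -> F u -> h u <= 1.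
  by move=> [h1 _] Fu; rewrite -(Fsph _ Fu : `|u| = 1) dual_unit_ball_le.
have [y Fy gy] : exists2 y, F y & g y < 1.
  apply: contrapT => nog; apply: noF; exists g => // u Fu.
  apply: le_anti; rewrite leF//= leNgt; apply/negP => gu.
  by apply: nog; exists u.
have half01 : 0 <= (2^-1 : R) <= 1 by rewrite invr_ge0 ler0n invf_le1 ?ler1n.
exists ((1 - 2^-1) *: x + 2^-1 *: y); first exact: (convex_setP F).1.
move=> h; rewrite inE linearD !linearZ /= /GRing.scale /= => /predU1P[->|hG].
  by have := leF _ _ gext Fx; lra.
have := leF h y; have := xG _ hG.
have hext : extreme_points (dual_unit_ball X) h by apply: Gext; rewrite inE hG orbT.
by move=> hx /(_ hext Fy); lra.
Qed.

(* Near the smooth point [y] the norm coincides with [f], so that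
   [`|y - s z| = 1 - s * f z] for small [s > 0]. *)
Lemma approx_BJ_orthogonal_smooth f y z (eps : R) : `|y| = 1 ->
    (forall g, extreme_points (dual_unit_ball X) g -> g y = 1 -> g = f) ->
    approx_BJ_orthogonal eps y z ->
  f z <= eps * `|z|.
Proof.
move=> y1 yf yz; have [c c1 yc] := dual_extreme_gap y1 yf.
have fy : f y = 1.
  have [g gext gy] := dual_extreme_norming Xpoly y.
  by rewrite -(yf g) ?gy.
rewrite leNgt; apply/negP => lt_fz.
have z1 : 0 < 2 * `|z| + 1 by rewrite ltr_wpDl// mulr_ge0.
have fz1 : 0 < f z ^+ 2 + 1 by rewrite ltr_wpDl// sqr_ge0.
(* The first bound makes [f] norm [y - s z]; the second makes the linear gain [f z - eps |z|] beat
   the quadratic term. Adding 1 keeps the denominators positive. *)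
pose s := Num.min ((1 - c) / (2 * `|z| + 1)) ((f z - eps * `|z|) / (f z ^+ 2 + 1)).
have s0 : 0 < s by rewrite lt_min !divr_gt0// subr_gt0.
have sc : s * (2 * `|z| + 1) <= 1 - c by rewrite -ler_pdivlMr// ge_min lexx.
have sf : s * (f z ^+ 2 + 1) <= f z - eps * `|z|.
  by rewrite -ler_pdivlMr// ge_min lexx orbT.
have norm_yz : `|y + - s *: z| = 1 - s * f z.
  have [g gext gyz] := dual_extreme_norming Xpoly (y + - s *: z).
  have [gf|gf] := eqVneq g f.
    by rewrite -gyz gf linearD linearZ /= fy /GRing.scale /= mulNr.
  have := yc _ gext gf; move: gyz; rewrite linearD linearZ /= /GRing.scale /=.
  have := lerB_normD y (- s *: z); rewrite y1 normrZ normrN (gtr0_norm s0).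
  have := dual_unit_ball_le (- z) gext.1; rewrite linearN normrN => gz.
  have := ler_wpM2l (ltW s0) gz.
  by lra.
have := yz (- s); rewrite norm_yz y1 normrZ normrN (gtr0_norm s0) expr1n mulr1.
nra.
Qed.

End facets.

Theorem theorem2p20 (R : realType) (X : finNormedModType R) (Y : {vspace X})
    (Xpoly : polyhedral X) (Yproper : Y != fullv) (dimY : (1 < \dim Y)%N) :
  [<-> strongly_anti_coproximinal Y;
       forall F : set X, facet F -> [set` Y] `&` relative_interior F !=set0;
       smooth_functionals Y = extreme_points (dual_unit_ball X)].
Proof.
have X_neq0 : exists v : X, v != 0.
  exists (vpick Y); rewrite vpick0; apply/eqP => Y0.
  by move: dimY; rewrite Y0 dimv0.
have sphere_neq0 (y : X) : `|y| = 1 -> y != 0.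
  by move=> y1; rewrite -normr_eq0 y1 oner_neq0.
tfae.
- move=> Yanti F /(facet_exposed_face Xpoly X_neq0)[f fext ->]; have [f1 _] := fext.
  apply: contrapT => noY.
  (* In terms of functionals: no unit vector of [Y] has [f] as its only extreme norming
     functional. *)
  have {}noY y : y \in Y -> `|y| = 1 -> f y = 1 ->
      ~ forall g, extreme_points (dual_unit_ball X) g -> g y = 1 -> g = f.
    move=> yY y1 fy yf; apply: noY; exists y; split => //.
    exact: relative_interior_exposed_face.
  have [z [z1 fz zf]] := dual_exposing_point Xpoly fext X_neq0.
  have zY : z \notin Y.
    by apply/negP => zY; apply: (noY z) => // g [g1 _]; exact: zf.
  (* Only [f] and [- f] norm [z], so the other extreme functionals, finite in
     number, are uniformly smaller on [z]. *)
  have /finite_seqP[G GE] := finite_dual_extreme_points Xpoly.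
  have [g|c c1 zc] := @seq_strict_bound _ _
      [seq g <- G | (g != f) && (g != - f)] (fun g => `|g z|) 1.
    rewrite mem_filter => /andP[/andP[gf gNf] gG].
    have [g1 _] : extreme_points (dual_unit_ball X) g by rewrite GE.
    rewrite ltr_norml ltrNl -linearN !lt_neqAle -{2 4}z1 -{1}normrN.
    rewrite !dual_unit_ball_le// !andbT; apply/andP; split.
      apply: contra_neq gNf => gz; rewrite -[g]opprK; congr (- _).
      apply: zf; first exact: dual_unit_ballN.
      by rewrite opp_lfunE -linearN.
    by apply: contra_neq gf => /zf ->.
  (* [c] is only known to be below 1, whereas [eps] must also be nonnegative. *)
  pose eps := Num.max 0 c.
  apply: (Yanti z eps zY).
    by rewrite le_max lexx gt_max ltr01 c1.
  have zeps g : extreme_points (dual_unit_ball X) g -> g != f -> g != - f ->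
      `|g z| <= eps.
    move=> gext gf gNf; rewrite le_max zc ?orbT// mem_filter gf gNf.
    by move: gext; rewrite GE.
  (* Some extreme functional other than [f] norms [y]; it is not [- f], which is negative at [y]. *)
  have pos y : y \in Y -> y != 0 -> f y = `|y| -> exists g,
      [/\ dual_unit_ball X g, g y = `|y| & `|g z| <= eps].
    move=> yY y0 fy; apply: contrapT => nog.
    have y0' : 0 < `|y| by rewrite normr_gt0.
    apply: (noY (`|y|^-1 *: y)); first exact: memvZ.
    - by rewrite normrZ gtr0_norm ?invr_gt0// mulVf ?gt_eqF.
    - by rewrite linearZ /= fy /GRing.scale /= mulVf ?gt_eqF.
    move=> g gext; rewrite linearZ /= /GRing.scale /= mulrC => /divr1_eq gy.
    apply/eqP/negPn/negP => gf; apply: nog; exists g; split => //.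
      by case: gext.
    apply: zeps => //; apply/eqP => gNf; move: y0'.
    by rewrite -{1}gy gNf opp_lfunE fy oppr_gt0 normr_lt0.
  have norming y : y \in Y -> y != 0 -> exists g,
      [/\ dual_unit_ball X g, g y = `|y| & `|g z| <= eps].
    move=> yY y0; have [g gext gy] := dual_extreme_norming Xpoly y.
    have [gf|gf] := eqVneq g f; first by apply: pos; rewrite // -gf.
    have [gNf|gNf] := eqVneq g (- f); last first.
      by exists g; split; [case: gext|exact: gy|exact: zeps].
    (* If [- f] norms [y], then [f] norms [- y], and the functional found there is negated. *)
    have [|||h [h1 hy hz]] := pos (- y); rewrite ?rpredN ?oppr_eq0//.
      by rewrite normrN -gy gNf opp_lfunE linearN.
    exists (- h); split; first exact: dual_unit_ballN.
      by rewrite opp_lfunE -linearN; exact: etrans hy (normrN y).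
    by rewrite opp_lfunE normrN.
  exists 0; rewrite /best_coapproximation mem0v subr0; split=> // y yY lambda.
  have [->|y0] := eqVneq y 0.
    by rewrite normr0 mulr0 mul0r expr0n subr0 sqr_ge0.
  have [g [g1 gy gz]] := norming y yY y0.
  rewrite normrZ z1 mulr1.
  have lower : `|y| - eps * `|lambda| <= `|y + lambda *: z|.
    apply: le_trans (dual_unit_ball_le _ g1).
    have -> : g (y + lambda *: z) = `|y| + lambda * g z.
      by rewrite linearD linearZ /= gy.
    by rewrite lerD2l; apply: lerNnormlW; rewrite normrM mulrC ler_wpM2r.
  have eps0 : 0 <= eps * `|lambda| by rewrite mulr_ge0// le_max lexx.
  have {}pos := normr_ge0 y.
  rewrite (_ : _ * `|lambda| = 2 * (eps * `|lambda|) * `|y|); last by ring.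
  (* [lower] can be squared when its left side is nonnegative; otherwise the required bound is
     itself nonpositive. *)
  have [le_ey|lt_ye] := leP (eps * `|lambda|) `|y|.
    have : (`|y| - eps * `|lambda|) ^+ 2 <= `|y + lambda *: z| ^+ 2.
      by rewrite ler_sqr ?nnegrE ?subr_ge0.
    by have := sqr_ge0 (eps * `|lambda|); nra.
  by apply: le_trans (sqr_ge0 _); have := ltW lt_ye; nra.
(* A unique support functional is extreme, since both ends of a segment through it also support [y].
   Conversely, a point of [Y] interior to the facet of an extreme [f] is smooth. *)
- move=> Yint; apply/seteqP; split=> [f [f1 [y [[y0 [f' yf']] yY y1 fy]]]|f fext].
    have yf : support_functionals y = [set f].
      suff -> : f = f' by [].
      have : support_functionals y f by split=> //; rewrite y1.
      by rewrite yf'.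
    split=> [|g h t g1 h1 t01 fE]; first exact: dual_unit_sphere_ball.
    have [gy hy] : g y = 1 /\ h y = 1.
      apply: conv_eq_max t01 _.
      - by rewrite -y1 dual_unit_ball_le.
      - by rewrite -y1 dual_unit_ball_le.
      - by rewrite -[RHS]fy fE add_lfunE !scale_lfunE.
    have unique k : dual_unit_ball X k -> k y = 1 -> k = f.
      move=> k1 ky; have : support_functionals y k.
        by apply/support_functionalsP => //; rewrite ky y1.
      by rewrite yf.
    by split; exact: unique.
  have [y [yY yint]] := Yint _ (exposed_face_facet Xpoly X_neq0 fext).
  have [[y1 fy] _] := (relative_interiorP _ _).1 yint.
  have yf := relative_interior_exposed_face_unique Xpoly fext yint.
  have y0 := sphere_neq0 _ y1.
  have Jyf : support_functionals y f.
    by apply/support_functionalsP => //; split; [case: fext|rewrite y1].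
  split; first by case: Jyf.
  exists y; split=> //; split=> //; exists f; apply/seteqP; split=> [g|_ -> //].
  by move=> /(support_functionalsP _ y0)[g1]; rewrite y1 => /(yf _ g1).
(* An extreme [f] norming [x - y0] supports a smooth [y] in [Y], and orthogonality at [y] would
   bound the norm of [x - y0] by [eps] times itself. *)
- move=> JY x eps xY /andP[eps0 eps1] [y0 [y0Y yperp]].
  have z0 : 0 < `|x - y0|.
    rewrite normr_gt0 subr_eq0; apply: contraNneq xY => ->; exact: y0Y.
  have [f fext fz] := dual_extreme_norming Xpoly (x - y0).
  move: (fext); rewrite -JY => -[f1 [y [[yn0 [f' yf']] yY y1 fy]]].
  have ff' : f = f'.
    have : support_functionals y f by split=> //; rewrite y1.
    by rewrite yf'.
  have := @approx_BJ_orthogonal_smooth _ _ Xpoly f y (x - y0) eps y1 _ (yperp y yY).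
  rewrite fz leNgt => /(_ _)/negP; apply; last by rewrite gtr_pMl.
  move=> g [g1 _] gy; have : support_functionals y g.
    by apply/support_functionalsP => //; rewrite gy y1.
  by rewrite yf' ff'.
Qed.
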